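(* Let $(H,X)$ be an admissible pair and let $\varphi$ be a nonzero vector in $H$. The following are equivalent: (a) $\varphi$ is norm attaining in $X$, i.e. $\|\varphi\|_X = \|\varphi\|_H$. (b) $\varphi$ is in $X^\ast$ and $\|\varphi\|_{X^\ast} = \|\varphi\|_H$.
   Context: All spaces are over the complex numbers, and $\langle\cdot,\cdot\rangle$ is the inner product of $H$, linear in the first argument. An admissible pair $(H,X)$ is a Hilbert space $H$ that can be embedded as a dense subspace of a Banach space $X$ such that the norm of the embedding is $1$; $H$ is identified with its image in $X$, so $\|f\|_X \leq \|f\|_H$ for every $f$ in $H$. A nonzero vector $\varphi$ in $H$ is called norm attaining in $X$ if $\|\varphi\|_X = \|\varphi\|_H$. $X^\ast$ denotes the dual space of $X$. Every $\Psi$ in $X^\ast$ restricts to a bounded linear functional on $H$, so by the Riesz representation theorem there is a unique $\psi$ in $H$ such that $\Psi(f) = \langle f,\psi\rangle$ for every $f$ in $H$. This embeds $X^\ast$ as a subspace of $H$ (antilinearly). A vector $\psi$ in $H$ is said to be in $X^\ast$ if it belongs to this subspace, i.e. if $f \mapsto \langle f,\psi\rangle$, $f \in H$, extends to a bounded linear functional $\Psi$ on $X$; in that case $\|\psi\|_{X^\ast}$ denotes $\|\Psi\|_{X^\ast}$. *)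

(* Defs.v *)
From HB Require Import structures.
From mathcomp Require Import all_boot all_order all_algebra sesquilinear complex.
From mathcomp Require Import all_classical all_reals all_analysis.
Import numFieldNormedType.Exports.

Set Implicit Arguments.
Unset Strict Implicit.
Unset Printing Implicit Defensive.

Import Order.TTheory GRing.Theory Num.Theory.

Local Open Scope classical_set_scope.
Local Open Scope ring_scope.
Local Open Scope complex_scope.

(* The complex numbers are R[i] with R : realType; the norm of an R[i]-normed
   module takes its (nonnegative real) values in R[i]. *)

(* The norm of the complete space H is the one induced by the inner product,
   that is, (H, dot) is a Hilbert space.  Forms in {dot H for conjC} are linear
   in the first argument and conjugate-linear in the second. *)
Definition hilbert_norm (R : realType) (H : completeNormedModType R[i])
    (dot : {dot H for Num.conj}) : Prop :=
  forall f : H, `|f| = sqrtC (dot f f).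

Definition bounded_operator (R : realType) (V W : normedModType R[i])
    (f : V -> W) : Prop :=
  exists M : R, forall x : V, `|f x| <= M%:C * `|x|.

(* [sup] is 0 on unbounded sets: this is the operator norm only when f is
   bounded. *)
Definition opnorm (R : realType) (V W : normedModType R[i])
    (f : V -> W) : R :=
  sup [set complex.Re `|f x| | x in [set x : V | `|x| <= 1]].

(* The identification of H with its image in X is made explicit as a linear
   map j. *)
Record admissible_pair (R : realType) (H X : completeNormedModType R[i])
    (dot : {dot H for Num.conj}) (j : {linear H -> X}) : Prop :=
  AdmissiblePair {
    admissible_hilbert : hilbert_norm dot;
    admissible_inj : injective j;
    admissible_dense : dense (range j);
    admissible_bounded : bounded_operator j;
    admissible_norm : opnorm j = 1 }.

Definition norm_attaining (R : realType) (H X : completeNormedModType R[i])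
    (j : {linear H -> X}) (phi : H) : Prop :=
  `|j phi| = `|phi|.

(* Psi is a bounded linear functional on X extending f |-> <f, psi>. *)
Definition dual_extension (R : realType) (H X : completeNormedModType R[i])
    (dot : {dot H for Num.conj}) (j : {linear H -> X}) (psi : H)
    (Psi : {linear X -> R[i]^o}) : Prop :=
  bounded_operator Psi /\ forall f : H, Psi (j f) = dot f psi.

Definition in_dual (R : realType) (H X : completeNormedModType R[i])
    (dot : {dot H for Num.conj}) (j : {linear H -> X}) (psi : H) : Prop :=
  exists Psi : {linear X -> R[i]^o}, dual_extension dot j psi Psi.

(* The norm of the extension, which is unique by density (see
   [dual_norm_extension]); meaningful only for psi in the dual of X. *)
Definition dual_norm (R : realType) (H X : completeNormedModType R[i])
    (dot : {dot H for Num.conj}) (j : {linear H -> X}) (psi : H) : R :=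
  get [set r : R | exists2 Psi : {linear X -> R[i]^o},
                     dual_extension dot j psi Psi & r = opnorm Psi].

Lemma bounded_operator_continuous (R : realType) (V W : normedModType R[i])
    (f : {linear V -> W}) : bounded_operator f -> continuous f.
Proof.
move=> [M Mf]; apply/linear_bounded_continuous/linear_boundedP.
exists M%:C; split; first by rewrite complex_real.
move=> r Mr x; apply: (le_trans (Mf x)).
by apply: ler_wpM2r; [exact: normr_ge0 | exact: ltW].
Qed.

Lemma dual_norm_extension (R : realType) (H X : completeNormedModType R[i])
    (dot : {dot H for Num.conj}) (j : {linear H -> X}) (psi : H)
    (Psi : {linear X -> R[i]^o}) :
  admissible_pair dot j -> dual_extension dot j psi Psi ->
  dual_norm dot j psi = opnorm Psi.
Proof.
move=> adm ext; rewrite /dual_norm.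
set A := [set r : R | _].
have [Psi' ext' ->] : A (get A) by apply: (@getPex _ A); exists (opnorm Psi), Psi.
congr opnorm; apply/funext => x.
apply/eqP; rewrite -subr_eq0; apply/negPn/negP => nz.
pose D : X -> R[i]^o := fun y => Psi' y - Psi y.
have contD : continuous D.
  move=> y; apply: cvgB.
    by apply: bounded_operator_continuous; case: ext'.
  by apply: bounded_operator_continuous; case: ext.
have opD : open (D @^-1` (~` [set 0])).
  apply: open_comp; first by move=> y _; exact: contD.
  apply: closed_openC; apply: accessible_closed_set1.
  exact/hausdorff_accessible/norm_hausdorff.
have [y [nDy [f _ fy]]] :=
  admissible_dense adm (ex_intro _ x (elimN eqP nz)) opD.
apply: nDy; rewrite /= /D -fy.
by case: ext ext' => [_ ->] [_ ->]; rewrite subrr.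
Qed.

(* Main.v *)
Require Import Defs.
From HB Require Import structures.
From mathcomp Require Import all_boot all_order all_algebra sesquilinear complex.
From mathcomp Require Import all_classical all_reals all_analysis.
From mathcomp Require Import ring lra.
Import numFieldNormedType.Exports.

Set Implicit Arguments.
Unset Strict Implicit.
Unset Printing Implicit Defensive.

Import Order.TTheory GRing.Theory Num.Theory.

Local Open Scope classical_set_scope.
Local Open Scope ring_scope.
Local Open Scope complex_scope.

(** Both conditions amount to the single inequality
    |dot f phi| <= |phi| |j f| for all f in H.

    If phi is in the dual with norm |phi|, evaluating the extension at j phi
    gives |phi|^2 = dot phi phi <= |phi| |j phi|, hence |phi| <= |j phi|; the
    reverse inequality holds because j is a contraction.

    Conversely, let |j phi| = |phi|. The unit ball of X contains that of H and
    touches it at phi / |phi|, where the ball of H is smooth: a hyperplane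
    supporting the ball of X there can only be the tangent hyperplane of the
    ball of H. That the tangent hyperplane does support the ball of X is
    elementary ([le_norm_orthogonal]): if h is orthogonal to phi, then phi is
    a convex combination of phi + h and phi - s h, and |j (phi - s h)| <= |phi
    - s h| = |phi| + O(s^2); convexity of the norm of X along this line forces
    |phi| <= |j (phi + h)|. A vector f with dot f phi <> 0 is a multiple of
    such a phi + h, which gives the inequality ([norm_dot_le]). The
    functional, now bounded for the norm of X on a dense subspace, extends to
    X with the same bound ([dense_extension]); the bound is attained at j phi,
    so the dual norm of phi is |phi|. *)

(** * Real-valued norms *)

(** The norm of an R[i]-module lives in R[i], which is only partially ordered;
    its real part allows the inequalities to be handled in the ordered field
    R. *)
Definition rnorm {R : realType} {V : normedModType R[i]} (x : V) : R :=
  complex.Re `|x|.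

Lemma rnormE (R : realType) (V : normedModType R[i]) (x : V) :
  `|x| = (rnorm x)%:C.
Proof. by rewrite /rnorm RRe_real// normr_real. Qed.

Lemma rnorm_ge0 (R : realType) (V : normedModType R[i]) (x : V) : 0 <= rnorm x.
Proof. by rewrite -lecR -rnormE normr_ge0. Qed.

Lemma rnorm0 (R : realType) (V : normedModType R[i]) : rnorm (0 : V) = 0.
Proof. by rewrite /rnorm normr0. Qed.

Lemma rnorm_eq0 (R : realType) (V : normedModType R[i]) (x : V) :
  (rnorm x == 0) = (x == 0).
Proof. by rewrite -[RHS]normr_eq0 rnormE -(inj_eq (@complexI R)). Qed.

Lemma ler_rnormD (R : realType) (V : normedModType R[i]) (x y : V) :
  rnorm (x + y) <= rnorm x + rnorm y.
Proof. by rewrite -lecR rmorphD /= -!rnormE ler_normD. Qed.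

Lemma rnormB (R : realType) (V : normedModType R[i]) (x y : V) :
  rnorm (x - y) = rnorm (y - x).
Proof. by rewrite /rnorm distrC. Qed.

Lemma rnormZ (R : realType) (V : normedModType R[i]) (a : R[i]) (x : V) :
  rnorm (a *: x) = rnorm (a : R[i]^o) * rnorm x.
Proof.
by apply: (@complexI R); rewrite rmorphM /= -!rnormE normrZ.
Qed.

Lemma rnormZR (R : realType) (V : normedModType R[i]) (s : R) (x : V) :
  0 <= s -> rnorm (s%:C *: x) = s * rnorm x.
Proof.
move=> s0; rewrite rnormZ; congr (_ * _); apply: (@complexI R).
by rewrite -rnormE ger0_norm// lecR.
Qed.

(** * Operator norms *)

Lemma bounded_le_opnorm (R : realType) (V W : normedModType R[i])
    (f : {linear V -> W}) (x : V) :
  bounded_operator f -> rnorm (f x) <= opnorm f * rnorm x.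
Proof.
move=> [M Mf].
have fM y : rnorm (f y) <= M * rnorm y.
  by rewrite -lecR rmorphM /= -!rnormE.
have [->|x0] := eqVneq x 0; first by rewrite linear0 !rnorm0 mulr0.
have nx0 : 0 < rnorm x by rewrite lt_neqAle eq_sym rnorm_eq0 x0 rnorm_ge0.
have E : rnorm x * (rnorm x)^-1 = 1 by rewrite divff// gt_eqF.
have := @ub_le_sup _ [set complex.Re `|f y| | y in [set y : V | `|y| <= 1]].
move=> /(_ _ (rnorm (f ((rnorm x)^-1%:C *: x)))).
rewrite -/(opnorm f) linearZ/= rnormZR ?invr_ge0 ?rnorm_ge0//.
rewrite mulrC ler_pdivrMr//; apply.
  exists `|M| => _ [y /= y1 <-]; apply: (le_trans (fM y)).
  have y1' : rnorm y <= 1 by rewrite -lecR -rnormE.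
  apply: (@le_trans _ _ (`|M| * rnorm y)).
    by rewrite ler_wpM2r ?rnorm_ge0 ?ler_norm.
  by rewrite ler_piMr.
exists ((rnorm x)^-1%:C *: x) => /=.
  by rewrite rnormE rnormZR ?invr_ge0 ?rnorm_ge0// mulrC E.
by rewrite linearZ/= -/(rnorm _) rnormZR ?invr_ge0 ?rnorm_ge0// mulrC.
Qed.

Lemma opnorm_le (R : realType) (V W : normedModType R[i]) (f : V -> W) (K : R) :
  0 <= K -> (forall x, rnorm (f x) <= K * rnorm x) -> opnorm f <= K.
Proof.
move=> K0 fK; apply: ge_sup.
  by exists (rnorm (f 0)), 0 => //=; rewrite normr0.
move=> _ [y /= y1 <-]; apply: (le_trans (fK y)).
have y1' : rnorm y <= 1 by rewrite -lecR -rnormE.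
by rewrite ler_piMr.
Qed.

(** * Extension from a dense subspace *)

(** The supremum over f of l f - K |x - j f| is the least K-Lipschitz extension
    of l (McShane).  When j has dense range it is also the extension by
    continuity, obtained without taking limits. *)
Lemma lipschitz_extension (R : realType) (T : Type) (W : normedModType R[i])
    (t0 : T) (j : T -> W) (l : T -> R) (K : R) : 0 <= K ->
  (forall f g, l f - l g <= K * rnorm (j f - j g)) ->
  exists L : W -> R, forall x f, `|L x - l f| <= K * rnorm (x - j f).
Proof.
move=> K0 lip.
pose A x := [set l f - K * rnorm (x - j f) | f in [set: T]].
have ubA x f : ubound (A x) (l f + K * rnorm (x - j f)).
  move=> _ [g _ <-].
  have := lip g f; rewrite -(subrKA x (j g)) => lgf.
  have := ler_wpM2l K0 (ler_rnormD (j g - x) (x - j f)).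
  rewrite (rnormB (j g)); lra.
exists (fun x => sup (A x)) => x f.
have ? : sup (A x) <= l f + K * rnorm (x - j f).
  by apply: ge_sup => //; exists (l t0 - K * rnorm (x - j t0)), t0.
have ? : l f - K * rnorm (x - j f) <= sup (A x).
  by apply: ub_le_sup; [exists (l f + K * rnorm (x - j f)) | exists f].
by rewrite ler_distl; apply/andP; split; lra.
Qed.

Lemma dense_range_approx (R : realType) (T : Type) (W : normedModType R[i])
    (j : T -> W) (x : W) (e : R) :
  dense (range j) -> 0 < e -> exists f, rnorm (x - j f) < e.
Proof.
move=> dj e0.
have e0' : 0 < e%:C :> R[i] by rewrite ltcR.
have [||y [xy [f _ fy]]] := dj (ball x e%:C).
- by exists x; exact: ballxx.
- exact: ball_open.
exists f; move: xy; rewrite -ball_normE/= -fy.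
by rewrite rnormE ltcR.
Qed.

Lemma le0_of_le_small (R : realType) (a C : R) :
  (forall e, 0 < e -> a <= C * e) -> a <= 0.
Proof.
move=> h; rewrite leNgt; apply/negP => a0.
have C1 : 0 < `|C| + 1 by rewrite ltr_wpDl.
have := h _ (divr_gt0 a0 C1).
apply/negP; rewrite -ltNge mulrA ltr_pdivrMr// mulrC ltr_pM2l//.
by rewrite (le_lt_trans (ler_norm _))// ltrDl.
Qed.

(** The real and imaginary parts of l are extended separately.  This loses a
    factor 2 in the distance to l, but linearity and the bound with the original
    constant K are closed conditions: they are checked up to a multiple of e on
    e-approximants in the range of j, so the factor disappears as e tends to
    0. *)
Lemma dense_extension (R : realType) (V W : normedModType R[i])
    (j : {linear V -> W}) (l : {linear V -> R[i]^o}) (K : R) :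
  dense (range j) -> 0 <= K ->
  (forall f, rnorm (l f) <= K * rnorm (j f)) ->
  exists Psi : {linear W -> R[i]^o},
    (forall x, rnorm (Psi x) <= K * rnorm x) /\ forall f, Psi (j f) = l f.
Proof.
move=> dj K0 lK.
have lip f g : rnorm (l f - l g) <= K * rnorm (j f - j g).
  by rewrite -!linearB.
have Re_le (z : R[i]^o) : `|complex.Re z| <= rnorm z.
  by rewrite -lecR -rnormE; exact: normc_ge_Re.
have Im_le (z : R[i]^o) : `|complex.Im z| <= rnorm z.
  rewrite /rnorm normc_def /= -[leLHS]sqrtr_sqr.
  by rewrite ler_wsqrtr// lerDr sqr_ge0.
have [|L1 L1P] := @lipschitz_extension R V W (0 : V) j
    (fun f => complex.Re (l f)) K K0.
  move=> f g; rewrite -raddfB; apply: le_trans (lip f g).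
  exact: le_trans (ler_norm _) (Re_le _).
have [|L2 L2P] := @lipschitz_extension R V W (0 : V) j
    (fun f => complex.Im (l f)) K K0.
  move=> f g; rewrite -raddfB; apply: le_trans (lip f g).
  exact: le_trans (ler_norm _) (Im_le _).
pose P (x : W) : R[i]^o := L1 x +i* L2 x.
have rnorm_rect (u v : R) : rnorm (u +i* v : R[i]^o) <= `|u| + `|v|.
  rewrite /rnorm normc_def /= -[leRHS]ger0_norm ?addr_ge0//.
  rewrite -sqrtr_sqr ler_wsqrtr//.
  have := mulr_ge0 (normr_ge0 u) (normr_ge0 v).
  rewrite -(real_normK (num_real u)) -(real_normK (num_real v)); lra.
have PP x f : rnorm (P x - l f) <= 2 * K * rnorm (x - j f).
  have -> : P x - l f =
      (L1 x - complex.Re (l f)) +i* (L2 x - complex.Im (l f)).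
    by rewrite /P; case: (l f).
  have := rnorm_rect (L1 x - complex.Re (l f)) (L2 x - complex.Im (l f)).
  have := L1P x f; have := L2P x f; lra.
have Pj f : P (j f) = l f.
  apply/eqP; rewrite -subr_eq0 -rnorm_eq0 eq_le rnorm_ge0 andbT.
  by have := PP (j f) f; rewrite subrr rnorm0 mulr0.
have Plin : linear P.
  move=> a x y; apply/eqP; rewrite -subr_eq0 -rnorm_eq0 eq_le rnorm_ge0 andbT.
  pose A := rnorm (a : R[i]^o).
  apply: (@le0_of_le_small _ _ (4 * K * (A + 1))) => e e0.
  have [f fx] := dense_range_approx x dj e0.
  have [g gy] := dense_range_approx y dj e0.
  have A0 : 0 <= A := rnorm_ge0 _.
  have -> : P (a *: x + y) - (a *: P x + P y) =
      (P (a *: x + y) - l (a *: f + g)) +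
      (a *: (l f - P x) + (l g - P y)).
    by rewrite linearP scalerBr; ring.
  have h1 := PP (a *: x + y) (a *: f + g).
  have h2 : rnorm (a *: x + y - j (a *: f + g)) <=
      A * rnorm (x - j f) + rnorm (y - j g).
    by rewrite linearP opprD addrACA -scalerBr -rnormZ ler_rnormD.
  have h3 := PP x f; have h4 := PP y g.
  have h5 := ler_rnormD (P (a *: x + y) - l (a *: f + g))
    (a *: (l f - P x) + (l g - P y)).
  have h6 := ler_rnormD (a *: (l f - P x)) (l g - P y).
  rewrite rnormZ (rnormB (l f)) (rnormB (l g)) -/A in h6.
  have h7 := ler_wpM2l A0 h3.
  have h8 : K * (A * rnorm (x - j f)) <= K * (A * e).
    by rewrite !ler_wpM2l// ltW.
  have h9 := ler_wpM2l K0 (ltW gy).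
  have h10 := ler_wpM2l K0 h2.
  lra.
pose PsiL := GRing.isLinear.Build _ _ _ _ P Plin.
pose Psi : {linear W -> R[i]^o} := HB.pack P PsiL.
exists Psi; split => // x /=.
rewrite -subr_le0; apply: (@le0_of_le_small _ _ (3 * K)) => e e0.
have [f fx] := dense_range_approx x dj e0.
have h1 := ler_rnormD (P x - l f) (l f); rewrite subrK in h1.
have h2 := ler_rnormD (j f - x) x; rewrite subrK rnormB in h2.
have h3 := lK f; have h4 := PP x f.
have h5 := ler_wpM2l K0 (ltW fx).
have h6 := ler_wpM2l K0 h2.
lra.
Qed.

(** * Norm attaining vectors of a Hilbert space *)

Lemma sqr_rnorm (R : realType) (H : completeNormedModType R[i])
    (dot : {dot H for Num.conj}) (f : H) :
  hilbert_norm dot -> (rnorm f)%:C ^+ 2 = dot f f.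
Proof. by move=> hdot; rewrite -rnormE hdot sqrtCK. Qed.

Lemma rnorm_dot (R : realType) (H : completeNormedModType R[i])
    (dot : {dot H for Num.conj}) (f : H) :
  hilbert_norm dot -> rnorm (dot f f : R[i]^o) = rnorm f ^+ 2.
Proof.
move=> hdot; apply: (@complexI R); rewrite -rnormE rmorphXn /= (sqr_rnorm _ hdot).
by rewrite ger0_norm// dnorm_ge0.
Qed.

(** Orthogonality to phi in H implies Birkhoff-James orthogonality in X. *)
Lemma le_norm_orthogonal (R : realType) (H X : completeNormedModType R[i])
    (dot : {dot H for Num.conj}) (j : {linear H -> X}) (phi h : H) :
  hilbert_norm dot -> (forall f, rnorm (j f) <= rnorm f) ->
  rnorm (j phi) = rnorm phi -> dot h phi = 0 ->
  rnorm phi <= rnorm (j (phi + h)).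
Proof.
move=> hdot contr jphi oh.
set a := rnorm phi; set b := rnorm _; pose d := rnorm h.
have a0 : 0 <= a := rnorm_ge0 _.
have b0 : 0 <= b := rnorm_ge0 _.
have [//|ab] := leP a b.
have key s : 0 < s -> 2 * a * (a - b) <= d ^+ 2 * s.
  move=> s0.
  have pythagoras : rnorm (phi - s%:C *: h) ^+ 2 = a ^+ 2 + s ^+ 2 * d ^+ 2.
    apply: (@complexI R).
    have -> : (a ^+ 2 + s ^+ 2 * d ^+ 2)%:C =
        (rnorm phi)%:C ^+ 2 + s%:C ^+ 2 * (rnorm h)%:C ^+ 2.
      by rewrite -!rmorphXn -rmorphM -rmorphD.
    rewrite rmorphXn /= !(sqr_rnorm _ hdot) hnormBd; last first.
      by rewrite linearZr_LR/= hermC /= oh rmorph0 !mulr0.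
    by rewrite /= dnormZ ger0_norm// lecR ltW.
  (* phi is the convex combination of phi + h and phi - s h with weights
     s / (1 + s) and 1 / (1 + s). *)
  have := ler_rnormD (s%:C *: j (phi + h)) (j (phi - s%:C *: h)).
  rewrite rnormZR ?(ltW s0)//.
  have -> : s%:C *: j (phi + h) + j (phi - s%:C *: h) = (1 + s)%:C *: j phi.
    rewrite -!linearZ -linearD /=; congr (j _).
    by rewrite scalerDr addrACA subrr addr0 rmorphD/= scalerDl scale1r addrC.
  rewrite rnormZR; last by lra.
  have := contr (phi - s%:C *: h).
  set c := rnorm (phi - _) in pythagoras *.
  rewrite jphi -/a -/b => h1 h2.
  have h3 : a + s * (a - b) <= c by lra.
  have h4 : (a + s * (a - b)) ^+ 2 <= c ^+ 2.
    have : 0 <= s * (a - b) by rewrite mulr_ge0; lra.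
    by move=> ?; rewrite lerXn2r// nnegrE; lra.
  rewrite pythagoras in h4.
  (* The a ^+ 2 cancel, and what remains is divisible by s. *)
  rewrite -(ler_pM2l s0); have := sqr_ge0 (s * (a - b)); lra.
have : 2 * a * (a - b) <= 0 by apply: le0_of_le_small key.
nra.
Qed.

(** The supporting hyperplane of the ball of H at phi supports that of X. *)
Lemma norm_dot_le (R : realType) (H X : completeNormedModType R[i])
    (dot : {dot H for Num.conj}) (j : {linear H -> X}) (phi f : H) :
  hilbert_norm dot -> (forall f, rnorm (j f) <= rnorm f) -> phi != 0 ->
  rnorm (j phi) = rnorm phi ->
  rnorm (dot f phi : R[i]^o) <= rnorm phi * rnorm (j f).
Proof.
move=> hdot contr phi0 jphi.
have [->|df] := eqVneq (dot f phi) 0.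
  by rewrite rnorm0 mulr_ge0 ?rnorm_ge0.
have dp : dot phi phi != 0 by rewrite dnorm_eq0.
(* f = c (phi + h) with h orthogonal to phi. *)
pose c := dot f phi / dot phi phi.
have c0 : c != 0 by rewrite mulf_neq0 ?invr_eq0.
have oh : dot (c^-1 *: f - phi) phi = 0.
  by rewrite linearBl/= linearZl_LR/= /c invf_div divfK// subrr.
have := le_norm_orthogonal hdot contr jphi oh.
rewrite addrC subrK linearZ/= rnormZ => le.
have -> : dot f phi = c *: (dot phi phi : R[i]^o).
  by rewrite /c /GRing.scale/= divfK.
rewrite rnormZ.
have cc : rnorm (c : R[i]^o) * rnorm (c^-1 : R[i]^o) = 1.
  by rewrite -rnormZ /GRing.scale/= divff// /rnorm normr1.
have : rnorm (c : R[i]^o) * rnorm phi <=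
    rnorm (c : R[i]^o) * (rnorm (c^-1 : R[i]^o) * rnorm (j f)).
  by rewrite ler_wpM2l ?rnorm_ge0.
rewrite mulrA cc mul1r => cle.
rewrite (rnorm_dot _ hdot) expr2 mulrA mulrC ler_wpM2l ?rnorm_ge0//.
Qed.

(** * Norm attaining vectors and the dual of X *)

Theorem theorem1 (R : realType) (H X : completeNormedModType R[i])
    (dot : {dot H for Num.conj}) (j : {linear H -> X})
    (Hadm : admissible_pair dot j) (phi : H) (phi_neq0 : phi != 0) :
  norm_attaining j phi <->
  (in_dual dot j phi /\ (dual_norm dot j phi)%:C = `|phi|).
Proof.
have contr f : rnorm (j f) <= rnorm f.
  have := bounded_le_opnorm f (admissible_bounded Hadm).
  by rewrite (admissible_norm Hadm) mul1r.
have hdot := admissible_hilbert Hadm.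
have a0 : 0 < rnorm phi by rewrite lt_neqAle eq_sym rnorm_eq0 phi_neq0 rnorm_ge0.
have dpp := rnorm_dot phi hdot.
split.
  rewrite /norm_attaining !rnormE => /(@complexI R) jphi.
  pose dphi (f : H) : R[i]^o := dot f phi.
  have dphi_linear : linear dphi by move=> a u v; exact: linearPl.
  pose dphiL := GRing.isLinear.Build _ _ _ _ dphi dphi_linear.
  pose l : {linear H -> R[i]^o} := HB.pack dphi dphiL.
  have [Psi [Pb PE]] := @dense_extension _ _ _ _ l _ (admissible_dense Hadm) (ltW a0)
      (fun f => norm_dot_le f hdot contr phi_neq0 jphi).
  have bP : bounded_operator Psi.
    by exists (rnorm phi) => x; rewrite !rnormE -rmorphM lecR.
  have ext : dual_extension dot j phi Psi by split.
  split; first by exists Psi.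
  rewrite (dual_norm_extension Hadm ext); congr (_%:C).
  apply/eqP; rewrite eq_le opnorm_le ?(ltW a0)//=.
  have := bounded_le_opnorm (j phi) bP.
  by rewrite PE /= dpp jphi expr2 ler_pM2r.
move=> [[Psi ext] ]; rewrite (dual_norm_extension Hadm ext) rnormE.
move=> /(@complexI R) nP; case: ext => bP PE.
rewrite /norm_attaining !rnormE; congr (_%:C).
apply/eqP; rewrite eq_le contr/=.
by have := bounded_le_opnorm (j phi) bP; rewrite PE dpp nP expr2 ler_pM2l.
Qed.
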